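(* Let $2\le n<\infty$, let $R_1,\dots,R_n$ be commutative rings with $1\neq 0$, and let $R=R_1\times\cdots\times R_n$. Then the following statements are equivalent. (1) Every proper ideal of $R$ is a weakly 1-absorbing primary ideal of $R$. (2) $n=2$ and $R_1,R_2$ are fields.
   Context: All rings are commutative with $1\neq 0$. For an ideal $I$ of $R$, $\sqrt{I}=\{a\in R : a^m\in I \text{ for some positive integer } m\}$. A proper ideal $I$ of $R$ is called weakly 1-absorbing primary if whenever $a,b,c\in R$ are nonunit elements and $0\neq abc\in I$, then $ab\in I$ or $c\in\sqrt{I}$. *)

(* Defs.v *)
From HB Require Import structures.
From mathcomp Require Import all_boot all_algebra.
From mathcomp Require Import boolp classical_sets.

Set Implicit Arguments.
Unset Strict Implicit.
Unset Printing Implicit Defensive.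

Import GRing.Theory.
Local Open Scope ring_scope.

(* The product ring, with componentwise operations, on the type of dependent  *)
(* functions over a finite index type. When the index type is empty this is   *)
(* the zero ring, hence comPzRingType (see dffun_oner_neq0 for the other      *)
(* case).                                                                     *)
Section ProductRing.
Variables (I : finType) (R : I -> comNzRingType).
Local Notation prodR := {dffun forall i : I, R i}.
Implicit Types f g : prodR.

Definition dffun_zero : prodR := [ffun i : I => 0 : R i].
Definition dffun_opp f : prodR := [ffun i : I => - f i].
Definition dffun_add f g : prodR := [ffun i : I => f i + g i].
Definition dffun_one : prodR := [ffun i : I => 1 : R i].
Definition dffun_mul f g : prodR := [ffun i : I => f i * g i].

Fact dffun_addA : associative dffun_add.
Proof. by move=> f g h; apply/ffunP=> i; rewrite !ffunE addrA. Qed.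
Fact dffun_addC : commutative dffun_add.
Proof. by move=> f g; apply/ffunP=> i; rewrite !ffunE addrC. Qed.
Fact dffun_add0 : left_id dffun_zero dffun_add.
Proof. by move=> f; apply/ffunP=> i; rewrite !ffunE add0r. Qed.
Fact dffun_addN : left_inverse dffun_zero dffun_opp dffun_add.
Proof. by move=> f; apply/ffunP=> i; rewrite !ffunE addNr. Qed.

HB.instance Definition _ := GRing.isZmodule.Build prodR
  dffun_addA dffun_addC dffun_add0 dffun_addN.

Fact dffun_mulA : associative dffun_mul.
Proof. by move=> f g h; apply/ffunP=> i; rewrite !ffunE mulrA. Qed.
Fact dffun_mulC : commutative dffun_mul.
Proof. by move=> f g; apply/ffunP=> i; rewrite !ffunE mulrC. Qed.
Fact dffun_mul1 : left_id dffun_one dffun_mul.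
Proof. by move=> f; apply/ffunP=> i; rewrite !ffunE mul1r. Qed.
Fact dffun_mulDl : left_distributive dffun_mul dffun_add.
Proof. by move=> f g h; apply/ffunP=> i; rewrite !ffunE mulrDl. Qed.

HB.instance Definition _ := GRing.Zmodule_isComPzRing.Build prodR
  dffun_mulA dffun_mulC dffun_mul1 dffun_mulDl.

Lemma dffun_addE f g i : (f + g) i = f i + g i.
Proof. by rewrite ffunE. Qed.
Lemma dffun_mulE f g i : (f * g) i = f i * g i.
Proof. by rewrite ffunE. Qed.
Lemma dffun_oppE f i : (- f) i = - f i.
Proof. by rewrite ffunE. Qed.
Lemma dffun_zeroE i : (0 : prodR) i = 0.
Proof. by rewrite ffunE. Qed.
Lemma dffun_oneE i : (1 : prodR) i = 1.
Proof. by rewrite ffunE. Qed.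

Lemma dffun_oner_neq0 (i : I) : (1 : prodR) != 0.
Proof.
by apply/eqP=> /(congr1 (fun f : prodR => f i))/eqP; rewrite !ffunE oner_eq0.
Qed.

End ProductRing.

(* GRing.unit and fieldType require a chosen inverse operation; a bare        *)
(* commutative ring has none, so units and fields are defined by existence.   *)
Definition is_unit (R : comPzRingType) (x : R) : Prop := exists y : R, x * y = 1.

(* 1 != 0 is part of comNzRingType. *)
Definition is_field (R : comNzRingType) : Prop :=
  forall x : R, x <> 0 -> is_unit x.

(* idealr only covers proper ideals given by boolean predicates; here an      *)
(* ideal is an arbitrary subset.                                              *)
Definition is_ideal (R : comPzRingType) (I : set R) : Prop :=
  [/\ I 0, forall x y, I x -> I y -> I (x + y)
    & forall r x, I x -> I (r * x)].

Definition is_proper_ideal (R : comPzRingType) (I : set R) : Prop :=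
  is_ideal I /\ I <> [set: R]%classic.

Definition radical (R : comPzRingType) (I : set R) : set R :=
  [set a | exists2 m : nat, (0 < m)%N & I (a ^+ m)]%classic.

Definition weakly_1_absorbing_primary (R : comPzRingType) (I : set R) : Prop :=
  is_proper_ideal I /\
  forall a b c : R, ~ is_unit a -> ~ is_unit b -> ~ is_unit c ->
    a * b * c <> 0 -> I (a * b * c) -> I (a * b) \/ radical I c.

(* Main.v *)
Require Import Defs.
From mathcomp Require Import all_boot all_algebra.
From mathcomp Require Import boolp classical_sets.

(** (1) => (2): for [i != j] and a nonunit [x] of [R_i], let [e] be [0] at [j]
    and [1] elsewhere, and [c] be [x] at [i] and [1] elsewhere.  If [e c] were
    nonzero, the principal ideal generated by [e e c] would contain neither
    [e e] (look at [i]) nor a power of [c] (look at [j]).  Hence [e c = 0]: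
    its coordinate at [i] gives [x = 0], so every [R_i] is a field, and its
    coordinate at a third index would give [1 = 0], so [n = 2].

    (2) => (1): if [a b c != 0] then [a], [b], [c] are all supported at a single
    index, where [c] is invertible, so [a b] is a multiple of [a b c]. *)

Import GRing.Theory.
Local Open Scope ring_scope.

Lemma principal_is_ideal (R : comPzRingType) (p : R) :
  is_ideal [set f | exists r, f = r * p]%classic.
Proof.
split=> /=.
- by exists 0; rewrite mul0r.
- by move=> _ _ [r ->] [s ->]; exists (r + s); rewrite mulrDl.
- by move=> s _ [r ->]; exists (s * r); rewrite mulrA.
Qed.

Lemma not_is_unit0 (S : comNzRingType) : ~ is_unit (0 : S).
Proof. by case=> y /eqP; rewrite mul0r eq_sym oner_eq0. Qed.

Section Product.
Variables (I : finType) (R : I -> comNzRingType).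
Local Notation prodR := {dffun forall i : I, R i}.

Definition dffun_with (f : prodR) (i : I) (x : R i) : prodR :=
  finfun (dfwith f x).

Lemma dffun_with_in (f : prodR) (i : I) (x : R i) : dffun_with f i x i = x.
Proof. by rewrite ffunE dfwith_in. Qed.

Lemma dffun_with_out (f : prodR) (i : I) (x : R i) (j : I) :
  i != j -> dffun_with f i x j = f j.
Proof. by move=> ij; rewrite ffunE dfwith_out. Qed.

Lemma dffun_expE (f : prodR) m i : (f ^+ m) i = f i ^+ m.
Proof.
by elim: m => [|m IH]; rewrite ?expr0 ?dffun_oneE// !exprS dffun_mulE IH.
Qed.

Lemma dffun_is_unitP (f : prodR) : is_unit f <-> forall i, is_unit (f i).
Proof.
split=> [[g fg] i|U].
  by exists (g i); rewrite -dffun_mulE fg dffun_oneE.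
(* [is_unit] only asserts existence, so the global inverse is assembled by choosing one inverse in
   each coordinate. *)
exists (finfun (fun i => sval (cid (U i)))).
by apply/ffunP=> i; rewrite dffun_mulE dffun_oneE ffunE; case: cid.
Qed.

Lemma nonunit_coord_eq0 (f : prodR) :
  (forall i, is_field (R i)) -> ~ is_unit f -> exists i, f i = 0.
Proof.
move=> F nU; apply: contra_notP nU => /forallNP nz.
by apply/dffun_is_unitP => i; apply: F.
Qed.

Lemma nonunit_mul_eq0 (i j : I) (x : R i) :
  (forall J : set prodR, is_proper_ideal J -> weakly_1_absorbing_primary J) ->
  i != j -> ~ is_unit x -> dffun_with (dffun_with 1 i x) j 0 = 0.
Proof.
move=> H ij xN; have ji : j != i by rewrite eq_sym.
set p := dffun_with _ j 0; apply: contrapT => p0.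
pose e := dffun_with 1 j 0; pose c := dffun_with 1 i x.
(* Idempotence makes the triple product [e * e * c] equal to [p], the generator of the test
   ideal. *)
have ee : e * e = e.
  apply/ffunP=> k; rewrite dffun_mulE; have [<-|jk] := eqVneq j k.
    by rewrite dffun_with_in mul0r.
  by rewrite dffun_with_out // dffun_oneE mul1r.
have ec : e * c = p.
  apply/ffunP=> k; rewrite dffun_mulE; have [<-|jk] := eqVneq j k.
    by rewrite !dffun_with_in mul0r.
  by rewrite !(dffun_with_out _ j _ _ jk) dffun_oneE mul1r.
have eN : ~ is_unit e.
  by move/dffun_is_unitP/(_ j); rewrite dffun_with_in; apply: not_is_unit0.
have cN : ~ is_unit c by move/dffun_is_unitP/(_ i); rewrite dffun_with_in.
(* All multiples of [p] vanish at [j], whereas [1] and every power of [c] equal [1] there: the ideal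
   is proper and its radical misses [c]. *)
have pj r : (r * p) j = 0 by rewrite dffun_mulE dffun_with_in mulr0.
have Jproper : is_proper_ideal [set f | exists r, f = r * p]%classic.
  split; first exact: principal_is_ideal.
  move/seteqP => [_ /(_ 1 Logic.I)[r /(congr1 (fun f : prodR => f j))/eqP]].
  by rewrite pj dffun_oneE oner_eq0.
have [_ /(_ e e c eN eN cN)] := H _ Jproper.
rewrite ee ec => /(_ p0)[|[r er]|[m _ [r cr]]].
- by exists 1; rewrite mul1r.
(* At [i], the equation [e = r * p] reads [1 = r i * x]. *)
- apply: xN; exists (r i); move/(congr1 (fun f : prodR => f i)): er.
  rewrite dffun_mulE !(dffun_with_out _ j _ _ ji) dffun_with_in dffun_oneE => ->.
  by rewrite mulrC.
- move/(congr1 (fun f : prodR => f j))/eqP: cr.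
  by rewrite pj dffun_expE dffun_with_out // dffun_oneE expr1n oner_eq0.
Qed.

End Product.

Lemma ord2_neq_eq (i j k : 'I_2) : i != j -> i != k -> j = k.
Proof.
by move=> ij ik; apply/val_inj; case: i j k ij ik => [[|[|?]] ?] [[|[|?]] ?] [[|[|?]] ?].
Qed.

Lemma field2_weakly_1_absorbing_primary (R : 'I_2 -> comNzRingType)
    (J : set {dffun forall i : 'I_2, R i}) :
  (forall i, is_field (R i)) -> is_proper_ideal J ->
  weakly_1_absorbing_primary J.
Proof.
move=> F Jproper; split=> // a b c aN _ _ abc0 Jabc; left.
have [i abci0] : exists i, (a * b * c) i <> 0.
  apply: contra_notP abc0 => /forallNP abc0; apply/ffunP => i.
  by rewrite dffun_zeroE; apply: contrapT.
have [y cy] : is_unit (c i).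
  by apply: F => ci0; apply: abci0; rewrite dffun_mulE ci0 mulr0.
(* A zero of [a] cannot occur at [i], so [j] is the other index and [a] is supported at [i]. *)
have [j aj0] := nonunit_coord_eq0 _ _ _ F aN.
have ij : i != j.
  apply/eqP => ij; apply: abci0.
  by rewrite !dffun_mulE ij aj0 !mul0r.
(* The multiplier is [y] at [i], cancelling [c i], and [0] at the other index, where [a] vanishes
   anyway. *)
have -> : a * b = dffun_with _ _ 0 i y * (a * b * c).
  apply/ffunP=> k; have [<-|ik] := eqVneq i k.
    by rewrite !dffun_mulE dffun_with_in [RHS]mulrC -!mulrA cy mulr1.
  by rewrite !dffun_mulE -(ord2_neq_eq _ _ _ ij ik) aj0 !mul0r mulr0.
by case: Jproper => -[_ _ Jmul] _; apply: Jmul.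
Qed.

Local Close Scope ring_scope.

Theorem theorem14 (n : nat) (hn : (2 <= n)%N) (R : 'I_n -> comNzRingType) :
  (forall I : set {dffun forall i : 'I_n, R i},
     is_proper_ideal I -> weakly_1_absorbing_primary I)
  <-> (n = 2 /\ forall i : 'I_n, is_field (R i)).
Proof.
split=> [H|[n2 F] J]; last first.
  by subst n; apply: field2_weakly_1_absorbing_primary.
pose i0 : 'I_n := Ordinal (ltnW hn); pose i1 : 'I_n := Ordinal hn.
split.
  apply/eqP; rewrite eqn_leq hn andbT leqNgt; apply/negP => n3.
  (* Taking [x = 0] at [i0] gives the element that is [0] at [i0] and [i1] and [1] at every other
     index, in particular at index [2]. *)
  have /(congr1 (fun f : {dffun forall i, R i} => f (Ordinal n3)))/eqP :=
    nonunit_mul_eq0 _ _ i0 i1 _ H isT (not_is_unit0 _).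
  by rewrite !dffun_with_out // dffun_oneE dffun_zeroE oner_eq0.
move=> i x x0; apply: contrapT => xN.
have [j ij] : exists j : 'I_n, i != j.
  by have [->|] := eqVneq i i0; [exists i1 | exists i0].
have /(congr1 (fun f : {dffun forall i, R i} => f i)) :=
  nonunit_mul_eq0 _ _ i j x H ij xN.
by rewrite dffun_with_out 1?eq_sym // dffun_with_in dffun_zeroE.
Qed.
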